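(* For all objects $\xi,\eta$ with $N\xi$ and $N\eta$: if $s(\xi)=s(\eta)$, then $\xi=\eta$.
   Context: Setting. All reasoning is classical (with equality). $U$ is a nonempty universe of ''objects'' equipped with a total binary operation $U\times U\to U$, $(f,x)\mapsto f(x)$. Greek and Latin lowercase letters denote elements of $U$; all quantifiers over objects range over $U$. We say that $x$ is in the domain of $f$, written $x\in\mathrm{dom}(f)$, if $f(x)\neq f$ (so $x\notin\mathrm{dom}(f)$ means $f(x)=f$). An attribute of $k$ objects is a $k$-ary relation on $U$ definable by a first-order formula built from equality and the operation $f(x)$, with parameters from $U$ allowed. Definitions. For a unary attribute $\Gamma$: $M(\Gamma)$ means that there is an object $\phi$ such that every $\xi$ with $\Gamma\xi$ lies in $\mathrm{dom}(\phi)$; $D(\Gamma)\phi$ means that for all $\xi$, $\Gamma\xi$ holds if and only if $\xi\in\mathrm{dom}(\phi)$. $C\phi$ (''$\phi$ is an identity object'') means $\phi(\xi)=\xi$ for all $\xi\in\mathrm{dom}(\phi)$. $E\phi\xi$ means: if $\xi\notin\mathrm{dom}(\phi)$ then $\phi=\xi$ (that is, $\xi\in\mathrm{dom}(\phi)$ or $\xi=\phi$). $H\psi\phi$ (''$\psi$ is a successor of $\phi$'') means: $C\psi$, and for all $\xi$, $E\phi\xi$ if and only if $\xi\in\mathrm{dom}(\psi)$. Axioms assumed. (Object uniqueness) If $\phi\neq\psi$, there is $\xi$ with $\phi(\xi)\neq\psi(\xi)$ and such that $\xi\notin\mathrm{dom}(\phi)$ implies $\xi\in\mathrm{dom}(\psi)$.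 (Choice) For all unary attributes $\Gamma,\Delta$ and every binary attribute $\Sigma$: if $M(\Gamma)$ and for every $\xi$ with $\Gamma\xi$ there is $\eta$ with $\Delta\eta$ and $\eta\,\Sigma\,\xi$, then there is an object $f$ with $D(\Gamma)f$ such that for every $\xi$ with $\Gamma\xi$ one has $\Delta(f(\xi))$ and $f(\xi)\,\Sigma\,\xi$. (Universe) For every $\phi$ there is $\psi$ such that: $\phi\in\mathrm{dom}(\psi)$; for all $\xi\in\mathrm{dom}(\phi)$, $\phi(\xi)\in\mathrm{dom}(\psi)$; for all $\xi\in\mathrm{dom}(\phi)$ and all $\eta\in\mathrm{dom}(\xi)$, $\eta\in\mathrm{dom}(\psi)$; and for every $\xi\notin\mathrm{dom}(\psi)$ there is $\eta\in\mathrm{dom}(\xi)$ such that $\eta\in\mathrm{dom}(\phi)$ implies $\xi(\eta)\neq\eta$. (Infinity) For every $\phi$ there is $\psi$ with $\phi\in\mathrm{dom}(\psi)$ such that for every $\xi\in\mathrm{dom}(\psi)$ there is $\eta\in\mathrm{dom}(\psi)$ with $H\eta\xi$. Natural numbers. $o$ is a designated object with empty domain, i.e. $o(\eta)=o$ for all $\eta$ (such an object exists by the axioms). $S\phi$ (''$\phi$ has inductive domain'') means: $o\in\mathrm{dom}(\phi)$, and for every $\xi\in\mathrm{dom}(\phi)$ there is $\eta\in\mathrm{dom}(\phi)$ with $H\eta\xi$. $N\xi$ (''$\xi$ is a natural number'') means: $\xi\in\mathrm{dom}(\phi)$ for every $\phi$ with $S\phi$. $T\sigma$ means: $D(N)\sigma$,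 and $H\,\sigma(\xi)\,\xi$ for every $\xi$ with $N\xi$. $s$ is a designated object with $Ts$ (such an object exists by the axioms); thus $\mathrm{dom}(s)$ consists exactly of the natural numbers and $s(\xi)$ is a successor of $\xi$ for each natural number $\xi$. *)

(* Defs.v *)
(* Plain Rocq: only the Corelib prelude is used. *)

Record universe := Universe {
  obj :> Type;
  app : obj -> obj -> obj;
  obj_inhabited : inhabited obj
}.

Arguments app {u} f x.

(* First-order formulas over equality and the binary operation, with de Bruijn
   indices: a quantifier binds index 0 of its body. *)
Inductive term : Type :=
| tVar (n : nat)
| tApp (t u : term).

Inductive formula : Type :=
| fEq (t u : term)
| fNot (a : formula)
| fAnd (a b : formula)
| fOr (a b : formula)
| fImp (a b : formula)
| fAll (a : formula)
| fEx (a : formula).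

Definition push {U : Type} (x : U) (e : nat -> U) (n : nat) : U :=
  match n with
  | O => x
  | S m => e m
  end.

Fixpoint eval {U : universe} (e : nat -> U) (t : term) : U :=
  match t with
  | tVar n => e n
  | tApp t u => app (eval e t) (eval e u)
  end.

Fixpoint sat {U : universe} (e : nat -> U) (a : formula) : Prop :=
  match a with
  | fEq t u => eval e t = eval e u
  | fNot a => ~ sat e a
  | fAnd a b => sat e a /\ sat e b
  | fOr a b => sat e a \/ sat e b
  | fImp a b => sat e a -> sat e b
  | fAll a => forall x : U, sat (push x e) a
  | fEx a => exists x : U, sat (push x e) a
  end.

(* A unary (binary) attribute is a first-order definable relation. The objects
   it relates are the values of the first one (two) free variables; the
   environment e supplies the parameters, as values of the remaining ones. *)
Definition attribute1 {U : universe} (G : U -> Prop) : Prop :=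
  exists (a : formula) (e : nat -> U),
    forall x : U, G x <-> sat (push x e) a.

Definition attribute2 {U : universe} (R : U -> U -> Prop) : Prop :=
  exists (a : formula) (e : nat -> U),
    forall x y : U, R x y <-> sat (push x (push y e)) a.

(* Application is total: a value f(x) = f marks x as outside the domain of f. *)
Definition in_dom {U : universe} (x f : U) : Prop := app f x <> f.

Definition bounded {U : universe} (G : U -> Prop) : Prop :=
  exists phi : U, forall xi : U, G xi -> in_dom xi phi.

Definition has_domain {U : universe} (G : U -> Prop) (phi : U) : Prop :=
  forall xi : U, G xi <-> in_dom xi phi.

Definition is_identity {U : universe} (phi : U) : Prop :=
  forall xi : U, in_dom xi phi -> app phi xi = xi.

Definition in_dom_or_eq {U : universe} (phi xi : U) : Prop :=
  ~ in_dom xi phi -> phi = xi.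

Definition successor {U : universe} (psi phi : U) : Prop :=
  is_identity psi /\ forall xi : U, in_dom_or_eq phi xi <-> in_dom xi psi.

Definition object_uniqueness (U : universe) : Prop :=
  forall phi psi : U, phi <> psi ->
    exists xi : U, app phi xi <> app psi xi /\
      (~ in_dom xi phi -> in_dom xi psi).

Definition choice_axiom (U : universe) : Prop :=
  forall (G D : U -> Prop) (R : U -> U -> Prop),
    attribute1 G -> attribute1 D -> attribute2 R ->
    bounded G ->
    (forall xi : U, G xi -> exists eta : U, D eta /\ R eta xi) ->
    exists f : U, has_domain G f /\
      forall xi : U, G xi -> D (app f xi) /\ R (app f xi) xi.

Definition universe_axiom (U : universe) : Prop :=
  forall phi : U, exists psi : U,
    in_dom phi psi /\
    (forall xi : U, in_dom xi phi -> in_dom (app phi xi) psi) /\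
    (forall xi : U, in_dom xi phi ->
       forall eta : U, in_dom eta xi -> in_dom eta psi) /\
    (forall xi : U, ~ in_dom xi psi ->
       exists eta : U, in_dom eta xi /\
         (in_dom eta phi -> app xi eta <> eta)).

Definition infinity_axiom (U : universe) : Prop :=
  forall phi : U, exists psi : U,
    in_dom phi psi /\
    forall xi : U, in_dom xi psi ->
      exists eta : U, in_dom eta psi /\ successor eta xi.

Definition empty_domain {U : universe} (o : U) : Prop :=
  forall eta : U, app o eta = o.

Definition inductive_domain {U : universe} (o phi : U) : Prop :=
  in_dom o phi /\
  forall xi : U, in_dom xi phi ->
    exists eta : U, in_dom eta phi /\ successor eta xi.

Definition natural {U : universe} (o xi : U) : Prop :=
  forall phi : U, inductive_domain o phi -> in_dom xi phi.

Definition successor_object {U : universe} (o sigma : U) : Prop :=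
  has_domain (natural o) sigma /\
  forall xi : U, natural o xi -> successor (app sigma xi) xi.

(* Main.v *)
(** A natural number has a transitive domain and is not in its own domain, both by
    induction. Distinct numbers [xi], [eta] with the same successor would each lie in
    the domain of the other, so by transitivity [xi] would lie in its own domain. *)

From Stdlib Require Import Classical.
Require Import Defs.

Definition transitive_domain {U : universe} (x : U) : Prop :=
  forall z y : U, in_dom z x -> in_dom y z -> in_dom y x.

Lemma identity_ext (U : universe) (uniqueness : object_uniqueness U) (f g : U) :
  is_identity f -> is_identity g ->
  (forall x : U, in_dom x f <-> in_dom x g) -> f = g.
Proof.
  intros idf idg dom_fg. apply NNPP; intros neq.
  destruct (uniqueness f g neq) as [x [neq_x dom_x]].
  assert (xf : in_dom x f).
  { apply NNPP; intros nxf. apply nxf, dom_fg, dom_x, nxf. }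
  apply neq_x. rewrite (idf x xf). symmetry. apply idg, dom_fg, xf.
Qed.

Lemma successor_unique (U : universe) (uniqueness : object_uniqueness U)
    (f g x : U) :
  successor f x -> successor g x -> f = g.
Proof.
  intros [idf domf] [idg domg]. apply (identity_ext U uniqueness); trivial.
  intros y. rewrite <- (domf y). apply domg.
Qed.

Lemma in_dom_successor (U : universe) (f x y : U) :
  successor f x -> (in_dom y f <-> in_dom y x \/ y = x).
Proof.
  intros [_ domf]. rewrite <- (domf y). split.
  - intros H. destruct (classic (in_dom y x)) as [yx | nyx]; [now left | right].
    symmetry. exact (H nyx).
  - intros [yx | eq] nyx; [contradiction | now symmetry].
Qed.

Lemma natural_zero (U : universe) (o : U) : natural o o.
Proof. intros f [of _]. exact of. Qed.

Lemma natural_successor (U : universe) (uniqueness : object_uniqueness U)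
    (o x y : U) :
  natural o x -> successor y x -> natural o y.
Proof.
  intros nx yx f indf. destruct (proj2 indf x (nx f indf)) as [z [zf zx]].
  now rewrite (successor_unique U uniqueness y z x).
Qed.

Lemma comprehension (U : universe) (choice : choice_axiom U) (G : U -> Prop) :
  attribute1 G -> bounded G -> exists f : U, has_domain G f.
Proof.
  intros attG bG. destruct (obj_inhabited U) as [u].
  destruct (choice G (fun _ => True) (fun _ _ => True)) as [f [domf _]]; trivial.
  - exists (fEq (tVar 0) (tVar 0)), (fun _ => u). simpl. tauto.
  - exists (fEq (tVar 0) (tVar 0)), (fun _ => u). simpl. tauto.
  - intros x _. now exists u.
  - now exists f.
Qed.

Lemma natural_induction (U : universe) (choice : choice_axiom U)
    (o s : U) (hs : successor_object o s) (G : U -> Prop) :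
  attribute1 G ->
  (forall x : U, G x -> natural o x) ->
  G o ->
  (forall x : U, G x -> G (app s x)) ->
  forall x : U, natural o x -> G x.
Proof.
  intros attG GN Go GS x nx. destruct hs as [doms succ].
  destruct (comprehension U choice G attG) as [f domf].
  { exists s. intros y Gy. exact (proj1 (doms y) (GN y Gy)). }
  apply domf, nx. split.
  - apply domf, Go.
  - intros y yf. apply domf in yf. exists (app s y). split.
    + apply domf, GS, yf.
    + apply succ, GN, yf.
Qed.

Lemma transitive_domain_successor (U : universe) (f x : U) :
  successor f x -> transitive_domain x -> transitive_domain f.
Proof.
  intros fx tx z y zf yz. apply (in_dom_successor U f x y fx). left.
  apply (in_dom_successor U f x z fx) in zf. destruct zf as [zx | ->]; trivial.
  exact (tx z y zx yz).
Qed.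

Lemma not_in_own_dom_successor (U : universe) (f x : U) :
  successor f x -> transitive_domain x -> ~ in_dom x x -> ~ in_dom f f.
Proof.
  intros fx tx nxx ff.
  assert (xf : in_dom x f) by (apply (in_dom_successor U f x x fx); now right).
  apply nxx. apply (in_dom_successor U f x f fx) in ff.
  destruct ff as [fx' | eq].
  - exact (tx f x fx' xf).
  - now rewrite eq in xf.
Qed.

Lemma natural_transitive_irreflexive (U : universe)
    (uniqueness : object_uniqueness U) (choice : choice_axiom U)
    (o : U) (ho : empty_domain o) (s : U) (hs : successor_object o s) (x : U) :
  natural o x -> transitive_domain x /\ ~ in_dom x x.
Proof.
  intros nx.
  enough (H : in_dom x s /\ transitive_domain x /\ ~ in_dom x x) by apply H.
  revert x nx. apply (natural_induction U choice o s hs).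
  - pose (dom t u := fNot (fEq (tApp u t) u)).
    exists (fAnd (dom (tVar 0) (tVar 1))
             (fAnd
               (fAll (fAll (fImp (dom (tVar 1) (tVar 2))
                  (fImp (dom (tVar 0) (tVar 1)) (dom (tVar 0) (tVar 2))))))
               (fNot (dom (tVar 0) (tVar 0))))), (fun _ => s).
    intros x. reflexivity.
  - intros x [xs _]. exact (proj2 (proj1 hs x) xs).
  - split; [| split].
    + apply (proj1 (proj1 hs o)), natural_zero.
    + intros z y zo. now destruct (zo (ho z)).
    + intros oo. exact (oo (ho o)).
  - intros x [xs [tx nxx]]. apply (proj2 (proj1 hs x)) in xs.
    pose proof (proj2 hs x xs) as sx. split; [| split].
    + apply (proj1 (proj1 hs _)). now apply (natural_successor U uniqueness o x).
    + now apply (transitive_domain_successor U _ x).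
    + now apply (not_in_own_dom_successor U _ x).
Qed.

Theorem theorem57 (U : universe)
    (uniqueness : object_uniqueness U)
    (choice : choice_axiom U)
    (univ : universe_axiom U)
    (infinity : infinity_axiom U)
    (o : U) (ho : empty_domain o)
    (s : U) (hs : successor_object o s) :
  forall xi eta : U, natural o xi -> natural o eta ->
    app s xi = app s eta -> xi = eta.
Proof.
  intros xi eta nxi neta eq.
  pose proof (proj2 hs xi nxi) as sxi. pose proof (proj2 hs eta neta) as seta.
  rewrite <- eq in seta.
  assert (H1 : in_dom xi eta \/ xi = eta).
  { apply (in_dom_successor U _ eta xi seta), (in_dom_successor U _ xi xi sxi).
    now right. }
  assert (H2 : in_dom eta xi \/ eta = xi).
  { apply (in_dom_successor U _ xi eta sxi), (in_dom_successor U _ eta eta seta).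
    now right. }
  destruct H1 as [xi_eta |]; trivial. destruct H2 as [eta_xi |]; [| now symmetry].
  destruct (natural_transitive_irreflexive U uniqueness choice o ho s hs xi nxi)
    as [txi nxixi].
  destruct nxixi. exact (txi eta xi eta_xi xi_eta).
Qed.
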